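(* Let $G$ be an arbitrary connected graph on $n$ vertices, let $0<p<\frac{1}{2}$ be a noise parameter and let $0<\delta<\frac{1}{2}$ be a confidence threshold. There exists an adaptive Las Vegas graph searching algorithm (in the noisy graph search model described in the context, with an adversarially fixed target) that, after an expected number of at most $$\frac{1}{I(p)}\left(\log_2 n+\mathcal{O}(\log\log n)+\mathcal{O}(\log \delta^{-1})\right)$$ queries, returns the target correctly with probability at least $1-\delta$, for every choice of the target.
   Context: Noisy graph search model: $G=(V,E)$ is an undirected, unweighted connected graph and $v^*\in V$ is an unknown target. In each step the algorithm queries a vertex $q$. A correct answer is ''yes'' if $q=v^*$, and otherwise is a neighbor $u$ of $q$ lying on a shortest path from $q$ to $v^*$. Each answer, independently, is erroneous with probability $p$ (in which case it may be an arbitrary different answer); otherwise it is correct. The algorithm is adaptive; in the adversarial model the target is fixed in advance by an adversary who knows the algorithm, and in the Las Vegas setting the number of queries is random and the bound is on its expectation (for every fixed target). $H(p)=-p\log_2 p-(1-p)\log_2(1-p)$ and $I(p)=1-H(p)$. *)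

(* Defs.v *)
From HB Require Import structures.
From mathcomp Require Import all_boot all_order all_algebra.
From mathcomp Require Import all_classical all_reals all_analysis.
Set Implicit Arguments. Unset Strict Implicit. Unset Printing Implicit Defensive.
Import Order.TTheory GRing.Theory Num.Theory.
Local Open Scope ring_scope.

Section NoisyGraphSearch.
Variable R : realType.

Definition log2 (x : R) : R := ln x / ln 2.
Definition Hent (p : R) : R := - p * log2 p - (1 - p) * log2 (1 - p).
Definition Iinfo (p : R) : R := 1 - Hent p.

Variable V : finType.
Variable e : rel V.   (* simple undirected graph: symmetric, irreflexive *)

Definition on_shortest_path (q u t : V) : Prop :=
  exists s : seq V,
    [/\ path e q (u :: s), last u s = t &
        forall s' : seq V, path e q s' -> last q s' = t ->
          (size (u :: s) <= size s')%N].

(** Answers: [None] = "yes", [Some u] = "go to neighbour u". *)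
Definition correct_answer (t q : V) (a : option V) : Prop :=
  if q == t then a = None
  else exists u, a = Some u /\ on_shortest_path q u t.

Definition format_answer (q : V) (a : option V) : Prop :=
  a = None \/ exists u, a = Some u /\ e q u.

Definition history := seq (V * option V).

(** Randomized adaptive algorithm: given the history, a probability
    distribution on actions; [inl q] = query q, [inr v] = stop, return v. *)
Definition algorithm := history -> {ffun (V + V) -> R}.

Definition valid_algorithm (A : algorithm) : Prop :=
  forall h, (forall x, 0 <= A h x) /\ \sum_x A h x = 1.

(** Adversarial responder: given history and current query, it chooses the
    correct answer given when no error occurs (.1) and the erroneous answer
    given when an error occurs (.2). *)
Definition responder := history -> V -> option V * option V.

Definition valid_responder (t : V) (Rs : responder) : Prop :=
  forall h q, [/\ correct_answer t q (Rs h q).1,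
                  format_answer q (Rs h q).2 &
                  (Rs h q).2 <> (Rs h q).1].

Variables (p : R) (A : algorithm) (Rs : responder).

(** probability of answer a to query q after history h: each answer is
    independently erroneous with probability p. *)
Definition ans_prob (h : history) (q : V) (a : option V) : R :=
  (1 - p) * (a == (Rs h q).1)%:R + p * (a == (Rs h q).2)%:R.

Fixpoint reach_from (past rest : history) : R :=
  match rest with
  | [::] => 1
  | (q, a) :: rest' =>
      A past (inl q) * ans_prob past q a * reach_from (rcons past (q, a)) rest'
  end.

(** probability that the interaction produces the history h (i.e. that the
    first size h queries/answers are exactly h). *)
Definition reach (h : history) : R := reach_from [::] h.

Definition prob_stop_at (k : nat) : R :=
  \sum_(h : k.-tuple (V * option V)) reach h * \sum_(v : V) A h (inr v).

Definition prob_return_by (N : nat) (t : V) : R :=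
  \sum_(k < N.+1) \sum_(h : k.-tuple (V * option V)) reach h * A h (inr t).

(** E[number of queries] <= B, where E[T] = sum_k k P(T = k) if the
    algorithm terminates almost surely (and +oo otherwise). *)
Definition expected_queries_le (B : R) : Prop :=
  (forall eps : R, 0 < eps -> exists N : nat,
      1 - eps <= \sum_(k < N.+1) prob_stop_at k) /\
  (forall N : nat, \sum_(k < N.+1) k%:R * prob_stop_at k <= B).

Definition prob_return_ge (t : V) (c : R) : Prop :=
  forall eps : R, 0 < eps -> exists N : nat, c - eps <= prob_return_by N t.

End NoisyGraphSearch.

(* Main.v *)
(** Keep for every vertex [v] a weight, the product over the past answers of
    [2 (1 - p)] or [2 p] according to whether [v] is compatible with the answer,
    and query a weighted median.  Correctness for a worst-case target cannot be
    read off the weights without paying [2 log2 n]; instead a gambler is attached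
    to every [v], who, each time [v] is queried, adds a stake of [Iinfo p] and
    bets everything on the answer "yes".  The search returns a vertex whose
    gambler has reached wealth [Theta], which is of order [(log2 n + 2) / delta^2].

    With [W] the total weight, [w] the weight of the target and [g] the wealth of
    its gambler, [log2 (W / w) - log2 (1 + g)] decreases by at least [Iinfo p] on
    average at every query: through the first term when the query misses the
    target, through the second when it hits it.  It starts at [log2 n] and stays
    above [- log2 (3 + 2 Theta)], whence the expected time [T].  The bets on wrong
    vertices are unfavourable, so their total expected wealth is at most the
    total stake, [Iinfo p * T], and the error probability is at most
    [Iinfo p * T / Theta <= delta]. *)
Require Import Defs.
From HB Require Import structures.
From mathcomp Require Import all_boot all_order all_algebra.
From mathcomp Require Import all_classical all_reals all_analysis.
From mathcomp Require Import ring lra.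
Import Order.TTheory GRing.Theory Num.Theory.
Set Implicit Arguments.
Unset Strict Implicit.
Unset Printing Implicit Defensive.
Local Open Scope ring_scope.

(** * Elementary bounds on logarithms and on [Iinfo] *)

Section LogEstimates.
Variable R : realType.
Implicit Types p x y z g : R.

Lemma ln_le_subr1 x : 0 < x -> ln x <= x - 1.
Proof. by move=> x0; have := @le_ln1Dx R (x - 1); rewrite subrKC; apply; lra. Qed.

Lemma ln_lt_subr1 x : 0 < x -> x != 1 -> ln x < x - 1.
Proof.
move=> x0 x1; rewrite -ltr_expR lnK ?posrE//.
by have := @expR_gt1Dx R (x - 1); rewrite subrKC subr_eq0; apply.
Qed.

(** Concavity of [ln] between 1 and [y]: the tangent bound is applied at [y / m] and [1 / m], whose
    mean with weights [z] and [1 - z] is 1. *)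
Lemma ln_concave1 z y : 0 <= z -> z <= 1 -> 0 < y ->
  z * ln y <= ln (1 - z + z * y).
Proof.
move=> z0 z1 y0; set m := 1 - z + z * y.
have m0 : 0 < m.
  rewrite /m; have [->|zn1] := eqVneq z 1; first lra.
  by have : 0 <= z * y by [rewrite mulr_ge0// ltW|];
     have : z < 1 by [rewrite lt_neqAle zn1|]; lra.
have h1 := ln_le_subr1 (divr_gt0 y0 m0).
have h2 : ln m^-1 <= m^-1 - 1 by apply: ln_le_subr1; rewrite invr_gt0.
rewrite ln_div ?posrE// in h1; rewrite lnV ?posrE// in h2.
have h3 : z * (ln y - ln m) <= z * (y / m - 1) by rewrite ler_wpM2l.
have h4 : (1 - z) * - ln m <= (1 - z) * (m^-1 - 1).
  by rewrite ler_wpM2l// subr_ge0.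
have h5 : z * (y / m) + (1 - z) * m^-1 = 1.
  by rewrite /m; field; rewrite -/m gt_eqF.
lra.
Qed.

Lemma ln2_bounds : 1 / 2 <= ln 2 :> R /\ ln 2 <= 1 :> R.
Proof.
have := @ln_le_subr1 2 ltac:(lra).
have := @ln_le_subr1 2^-1 ltac:(lra).
rewrite lnV ?posrE; last lra.
lra.
Qed.

Lemma log2_le x y : 0 < x -> x <= y -> log2 x <= log2 y.
Proof.
move=> x0 xy; rewrite /log2 ler_pM2r ?invr_gt0 ?ln_gt0; try lra.
by rewrite ler_ln// ?posrE//; lra.
Qed.

Lemma log2M x y : 0 < x -> 0 < y -> log2 (x * y) = log2 x + log2 y.
Proof. by move=> x0 y0; rewrite /log2 lnM ?posrE// mulrDl. Qed.

Lemma log2_2 : log2 (2 : R) = 1.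
Proof. by rewrite /log2 divff//; have [? ?] := ln2_bounds; lra. Qed.

Lemma log2_ge0 x : 1 <= x -> 0 <= log2 x.
Proof. by move=> x1; rewrite /log2 divr_ge0 ?ln_ge0//; lra. Qed.

Lemma log2_le_id x : 0 < x -> log2 x <= x.
Proof.
move=> x0; have [h1 h2] := ln2_bounds.
rewrite /log2 ler_pdivrMr; last lra.
have := @ln_le_subr1 (x / 2) ltac:(lra).
rewrite ln_div ?posrE//; try lra.
have : x * (1 / 2) <= x * ln 2 by rewrite ler_pM2l.
nra.
Qed.

Lemma ler_ln2 x y : x * ln 2 <= y -> x <= y / ln 2.
Proof. by move=> h; rewrite ler_pdivlMr//; have [? ?] := ln2_bounds; lra. Qed.

Lemma Iinfo_ln p : 0 < p -> p < 1 / 2 ->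
  Iinfo p * ln 2 = (1 - p) * ln (2 * (1 - p)) + p * ln (2 * p).
Proof.
move=> p0 p2; have [? ?] := ln2_bounds.
rewrite !lnM ?posrE; try lra.
by rewrite /Iinfo /Hent /log2; field; lra.
Qed.

(** By [Iinfo_ln] this is the divergence of a coin of bias [p] from a fair one. The tangent bound at
    the reciprocals makes it positive, strictly since [2 * p] is not 1. *)
Lemma Iinfo_gt0 p : 0 < p -> p < 1 / 2 -> 0 < Iinfo p.
Proof.
move=> p0 p2; have [l1 l2] := ln2_bounds.
rewrite -(pmulr_lgt0 _ (_ : 0 < ln 2)); last lra.
rewrite Iinfo_ln//.
have a0 : 0 < 2 * (1 - p) by lra.
have b0 : 0 < 2 * p by lra.
have h1 : ln (2 * (1 - p))^-1 <= (2 * (1 - p))^-1 - 1.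
  by apply: ln_le_subr1; rewrite invr_gt0.
have h2 : ln (2 * p)^-1 < (2 * p)^-1 - 1.
  apply: ln_lt_subr1; first by rewrite invr_gt0.
  by rewrite invr_eq1; lra.
rewrite lnV ?posrE// in h1; rewrite lnV ?posrE// in h2.
have h3 : (1 - p) * - ln (2 * (1 - p)) <= (1 - p) * ((2 * (1 - p))^-1 - 1).
  by rewrite ler_wpM2l//; lra.
have h4 : p * - ln (2 * p) < p * ((2 * p)^-1 - 1) by rewrite ltr_pM2l.
have h5 : (1 - p) * (2 * (1 - p))^-1 = 1 / 2 by field; lra.
have h6 : p * (2 * p)^-1 = 1 / 2 by field; lra.
lra.
Qed.

Lemma Iinfo_le1 p : 0 < p -> p < 1 / 2 -> Iinfo p <= 1.
Proof.
move=> p0 p2; rewrite /Iinfo /Hent /log2; have [l1 l2] := ln2_bounds.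
have h1 : p * (ln p / ln 2) <= 0.
  rewrite mulr_ge0_le0//; first lra.
  by rewrite pmulr_lle0 ?invr_gt0; [apply: ln_le0|]; lra.
have h2 : (1 - p) * (ln (1 - p) / ln 2) <= 0.
  rewrite mulr_ge0_le0//; first lra.
  by rewrite pmulr_lle0 ?invr_gt0; [apply: ln_le0|]; lra.
lra.
Qed.

(* With a stake of [Iinfo p] added beforehand, betting on a coin of bias
   [1 - p] gains a full [Iinfo p] of log-wealth at every wealth level: the
   stake pays for the small wealths and the bet for the large ones. *)
Lemma log_wealth_drift p g : 0 < p -> p < 1 / 2 -> 0 <= g ->
  log2 (1 + g) + Iinfo p <=
  (1 - p) * log2 (1 + (g + Iinfo p) * (2 * (1 - p))) +
  p * log2 (1 + (g + Iinfo p) * (2 * p)).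
Proof.
move=> p0 p2 g0; have [l1 l2] := ln2_bounds.
have I0 := Iinfo_gt0 p0 p2; have I1 := Iinfo_le1 p0 p2; have IE := Iinfo_ln p0 p2.
set I := Iinfo p in I0 I1 IE *.
(* [z] is the fraction of [1 + x] that is put into the bet; [y] makes [1 + x] equal to [1 + g] times
   the mean of 1 and 2 with weights [1 - y] and [y]. *)
pose x := g + I; pose z := x / (1 + x); pose y := I / (1 + g).
have z0 : 0 <= z by rewrite divr_ge0// /x; lra.
have z1 : z <= 1 by rewrite ler_pdivrMr /x; lra.
have step r : 0 < r -> ln (1 + x) + z * ln r <= ln (1 + x * r).
  move=> r0; have -> : 1 + x * r = (1 + x) * (1 - z + z * r).
    by rewrite /z; field; rewrite /x; lra.
  have := ln_concave1 z0 z1 r0 => h.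
  have m0 : 0 < 1 - z + z * r.
    have [->|zn1] := eqVneq z 1; first lra.
    by have : 0 <= z * r by [rewrite mulr_ge0// ltW|];
       have : z < 1 by [rewrite lt_neqAle zn1|]; lra.
  by rewrite lnM ?posrE// /x; lra.
have h1 := step (2 * (1 - p)) ltac:(lra); have h2 := step (2 * p) ltac:(lra).
have y0 : 0 <= y by rewrite divr_ge0; lra.
have y1 : y <= 1 by rewrite ler_pdivrMr; lra.
have h3 : ln (1 + g) + y * ln 2 <= ln (1 + x).
  have -> : 1 + x = (1 + g) * (1 - y + y * 2).
    by rewrite /y /x; field; lra.
  by rewrite lnM ?posrE; [have := @ln_concave1 y 2 y0 y1 ltac:(lra); lra|lra..].
(* The stake earns at least [y] bits and the bet [z * I] bits; together they cover [I]. *)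
have h4 : I <= y + z * I.
  have -> : y + z * I = I + I * I / ((1 + g) * (1 + x)).
    by rewrite /y /z /x; field; lra.
  by rewrite lerDl divr_ge0 ?mulr_ge0// /x; lra.
have h5 : I * ln 2 <= y * ln 2 + z * (I * ln 2).
  by rewrite mulrA -mulrDl ler_wpM2r; lra.
have h8 : z * (I * ln 2) =
    (1 - p) * (z * ln (2 * (1 - p))) + p * (z * ln (2 * p)) by rewrite IE; ring.
have h6 : (1 - p) * (ln (1 + x) + z * ln (2 * (1 - p))) <=
    (1 - p) * ln (1 + x * (2 * (1 - p))) by rewrite ler_wpM2l//; lra.
have h7 : p * (ln (1 + x) + z * ln (2 * p)) <= p * ln (1 + x * (2 * p)).
  by rewrite ler_wpM2l//; lra.
rewrite -/x /log2 [(1 - p) * _]mulrA [p * (_ / _)]mulrA -mulrDl; apply: ler_ln2.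
rewrite mulrDl divfK; lra.
Qed.

End LogEstimates.

(** * One-step drift of the logarithmic share of the target *)

Section StepDrift.
Variable R : realType.

(** [C] and [E] stand for the weights compatible with the correct and the erroneous answer. The
    logarithm of each new total is bounded by its tangent at [W]; the linear terms average to at
    most 0, and the growth of the target's own weight leaves [Iinfo p]. *)
Lemma share_drift_other (p W w C E we : R) : 0 < p -> p < 1 / 2 ->
  0 < W -> 0 < w -> 0 <= C -> 0 <= E -> C <= W / 2 ->
  (E <= W / 2) || (C + E <= W) -> 2 * p * w <= we ->
  (1 - p) * log2 ((2 * p * W + 2 * (1 - 2 * p) * C) / (2 * (1 - p) * w)) +
    p * log2 ((2 * p * W + 2 * (1 - 2 * p) * E) / we)
  <= log2 (W / w) - Iinfo p.
Proof.
move=> p0 p2 W0 w0 C0 E0 CW EW we_ge; have [l1 l2] := ln2_bounds R.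
have pw : 0 < p * w by rewrite mulr_gt0.
have pW : 0 < p * W by rewrite mulr_gt0.
have qw : 0 < (1 - p) * w by rewrite mulr_gt0//; lra.
have we0 : 0 < we by lra.
pose c := C / W; pose d := E / W.
have bnd (D : R) : 0 <= D ->
    0 < 2 * p * W + 2 * (1 - 2 * p) * D /\
    ln (2 * p * W + 2 * (1 - 2 * p) * D)
      <= ln W + (1 - 2 * p) * (2 * (D / W) - 1).
  move=> D0; have D1 : 0 <= (1 - 2 * p) * D by rewrite mulr_ge0//; lra.
  have D2 : 0 <= (1 - 2 * p) * (D / W) by rewrite mulr_ge0 ?divr_ge0//; lra.
  split; first lra.
  have -> : 2 * p * W + 2 * (1 - 2 * p) * D
     = W * (1 + (1 - 2 * p) * (2 * (D / W) - 1)) by field; lra.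
  have := @le_ln1Dx R ((1 - 2 * p) * (2 * (D / W) - 1)) ltac:(lra).
  by rewrite lnM ?posrE//; lra.
have [Wc0 hc] := bnd _ C0; have [We0 he] := bnd _ E0.
have cd : (1 - p) * (2 * c - 1) + p * (2 * d - 1) <= 0.
  have c2 : c <= 1 / 2 by rewrite ler_pdivrMr//; lra.
  case/orP: EW => [EW|EW].
    have d2 : d <= 1 / 2 by rewrite ler_pdivrMr//; lra.
    have : (1 - p) * (2 * c - 1) <= 0 by rewrite mulr_ge0_le0; lra.
    have : p * (2 * d - 1) <= 0 by rewrite mulr_ge0_le0; lra.
    lra.
  (* A heavy [d] is paid for by a light [c]: the mean is at most [(1 - 2 * p) * (2 * c - 1)]. *)
  have d2 : d <= 1 - c.
    by rewrite lerBrDl -mulrDl ler_pdivrMr//; lra.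
  have : p * d <= p * (1 - c) by rewrite ler_pM2l.
  have : (1 - 2 * p) * (2 * c - 1) <= 0 by rewrite mulr_ge0_le0; lra.
  lra.
have hw : ln (2 * p) + ln w <= ln we.
  by rewrite -lnM ?posrE ?ler_ln ?posrE//; lra.
have hwc : ln (2 * (1 - p) * w) = ln (2 * (1 - p)) + ln w.
  by rewrite lnM ?posrE//; lra.
have lsum (a b : R) :
    (1 - p) * (a / ln 2) + p * (b / ln 2) = ((1 - p) * a + p * b) / ln 2.
  by field; lra.
rewrite /log2 lsum ler_pdivrMr; last lra.
rewrite [leRHS]mulrBl Iinfo_ln// divfK; last lra.
rewrite !ln_div ?posrE//; last lra.
have h1 := ler_wpM2l (_ : 0 <= 1 - p) hc; have h2 := ler_wpM2l (_ : 0 <= p) he.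
have h3 := ler_wpM2l (_ : 0 <= p) hw.
have {}h1 := h1 ltac:(lra); have {}h2 := h2 ltac:(lra); have {}h3 := h3 ltac:(lra).
have h4 : (1 - 2 * p) * ((1 - p) * (2 * c - 1) + p * (2 * d - 1)) <= 0.
  by rewrite mulr_ge0_le0//; lra.
rewrite -/c -/d in h1 h2; rewrite hwc; lra.
Qed.

(** Jensen's inequality through the tangent at [(w + U) / w]: for the largest admissible [We] the
    ratios of new to old inverse share average to exactly 1. *)
Lemma share_drift_target (p w U We : R) : 0 < p -> p < 1 / 2 ->
  0 < w -> 0 <= U -> 0 < We -> We <= 2 * p * w + 2 * (1 - p) * U ->
  (1 - p) * log2 ((2 * (1 - p) * w + 2 * p * U) / (2 * (1 - p) * w)) +
    p * log2 (We / (2 * p * w))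
  <= log2 ((w + U) / w).
Proof.
move=> p0 p2 w0 U0 We0 WeU; have [l1 l2] := ln2_bounds R.
have pw : 0 < p * w by rewrite mulr_gt0.
have qw : 0 < (1 - p) * w by rewrite mulr_gt0//; lra.
have pU : 0 <= p * U by rewrite mulr_ge0//; lra.
have qU : 0 <= (1 - p) * U by rewrite mulr_ge0//; lra.
have W0 : 0 < w + U by lra.
have key (a b : R) : 0 < a -> 0 < b -> ln a <= ln b + (a / b - 1).
  move=> a0 b0; have := ln_le_subr1 (divr_gt0 a0 b0).
  by rewrite ln_div ?posrE//; lra.
have h1 := key ((2 * (1 - p) * w + 2 * p * U) / (2 * (1 - p) * w)) ((w + U) / w).
have h2 := key (We / (2 * p * w)) ((w + U) / w).
have {}h1 := h1 ltac:(rewrite divr_gt0; lra) ltac:(rewrite divr_gt0; lra).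
have {}h2 := h2 ltac:(rewrite divr_gt0; lra) ltac:(rewrite divr_gt0; lra).
have h3 : We / (2 * p * w) / ((w + U) / w)
  <= (2 * p * w + 2 * (1 - p) * U) / (2 * p * w) / ((w + U) / w).
  by rewrite ler_pM2r ?invr_gt0 ?divr_gt0// ler_pM2r ?invr_gt0//; lra.
have h4 : (1 - p) * ((2 * (1 - p) * w + 2 * p * U) / (2 * (1 - p) * w) /
      ((w + U) / w))
    + p * ((2 * p * w + 2 * (1 - p) * U) / (2 * p * w) / ((w + U) / w)) = 1.
  by field; lra.
have lsum (a b : R) :
    (1 - p) * (a / ln 2) + p * (b / ln 2) = ((1 - p) * a + p * b) / ln 2.
  by field; lra.
rewrite /log2 lsum ler_pdivrMr; last lra.
rewrite divfK; last lra.
have {}h1 := ler_wpM2l (_ : 0 <= 1 - p) h1; have {}h2 := ler_wpM2l (_ : 0 <= p) h2.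
have {}h3 := ler_wpM2l (_ : 0 <= p) h3.
have {}h1 := h1 ltac:(lra); have {}h2 := h2 ltac:(lra); have {}h3 := h3 ltac:(lra).
lra.
Qed.

End StepDrift.

(** * Summation by parts for tails, [m k] being the probability of at least [k] queries *)

Section SurvivalSums.
Variables (R : realType) (m : nat -> R).
Hypotheses (m0 : m 0%N = 1) (m_ge0 : forall k, 0 <= m k).
Hypothesis m_dec : forall k, m k.+1 <= m k.
Variables (c B : R).
Hypotheses (c0 : 0 < c) (sumB : forall N, c * \sum_(k < N) m k.+1 <= B).

Lemma sum_survival_diff N : \sum_(k < N) (m k - m k.+1) = 1 - m N.
Proof.
elim: N => [|N IH]; first by rewrite big_ord0 m0 subrr.
by rewrite big_ord_recr /= IH; ring.
Qed.

Lemma survival_small (eps : R) : 0 < eps -> exists N, m N.+1 <= eps.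
Proof.
move=> e0; have ec : 0 < eps * c by rewrite mulr_gt0.
have [N /ltW BN] : exists N : nat, B / (eps * c) < N%:R.
  have B0 : 0 <= B by have := sumB 0; rewrite big_ord0 mulr0.
  by exists (Num.bound (B / (eps * c))); apply: archi_boundP; rewrite divr_ge0// ltW.
exists N; rewrite leNgt; apply/negP => eN.
have low n : m n * n%:R <= \sum_(k < n) m k.+1.
  rewrite mulr_natr -[X in _ *+ X](card_ord n) -sumr_const; apply: ler_sum => i _.
  have anti a b : (a <= b)%N -> m b <= m a.
    by move/subnK<-; elim: (b - a)%N => // k IH; rewrite addSn (le_trans (m_dec _)).
  exact: anti (ltn_ord i).
have := sumB N.+1; rewrite leNgt => /negP; apply.
rewrite ler_pdivrMr// in BN.
have h1 : c * (m N.+1 * N.+1%:R) <= c * \sum_(k < N.+1) m k.+1.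
  by rewrite ler_pM2l.
apply: (lt_le_trans _ h1); apply: (le_lt_trans BN).
have n0 : 0 <= N%:R :> R by [].
rewrite -natr1.
have h2 : N%:R * (eps * c) <= N%:R * (m N.+1 * c).
  by rewrite ler_wpM2l// ler_pM2r// ltW.
have h3 : 0 < m N.+1 * c by rewrite mulr_gt0// (lt_trans e0).
lra.
Qed.

(** Abel summation; the boundary term [N%:R * m N.+1] enters with a minus sign and is dropped. *)
Lemma sum_survival_mean N : \sum_(k < N.+1) k%:R * (m k - m k.+1) <= B / c.
Proof.
have -> : \sum_(k < N.+1) k%:R * (m k - m k.+1)
    = \sum_(k < N) m k.+1 - N%:R * m N.+1.
  elim: N => [|N IH]; first by rewrite big_ord_recr !big_ord0 /=; ring.
  by rewrite big_ord_recr /= IH big_ord_recr /= -natr1; ring.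
rewrite ler_pdivlMr//; have := sumB N; have : 0 <= N%:R * m N.+1.
  by rewrite mulr_ge0.
by move=> h1 h2; have : 0 <= N%:R * m N.+1 * c by [rewrite mulr_ge0// ltW|]; lra.
Qed.

End SurvivalSums.

(** * Sums over histories split at the last entry, and sums against a point mass *)

Lemma sum_rcons_tuple (R : realType) (T : finType) k (F : seq T -> R) :
  \sum_(h : k.+1.-tuple T) F h = \sum_(h : k.-tuple T) \sum_(x : T) F (rcons h x).
Proof.
rewrite pair_bigA /=.
rewrite (reindex (fun y : k.-tuple T * T => [tuple of rcons y.1 y.2])) //.
exists (fun h : k.+1.-tuple T =>
  ([tuple of belast (thead h) (behead h)], last (thead h) (behead h))) => [[h x] _|h _].
  have E : rcons h x = thead [tuple of rcons h x] :: behead [tuple of rcons h x].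
    by case: h => [[|a h] ?].
  have : rcons h x = rcons (belast (thead [tuple of rcons h x]) (behead [tuple of rcons h x]))
     (last (thead [tuple of rcons h x]) (behead [tuple of rcons h x])).
    by rewrite -lastI.
  by move=> /rcons_inj [hE xE]; congr pair => //; apply: val_inj.
apply: val_inj; rewrite /= -lastI.
by case/tupleP: h => a h.
Qed.

Lemma sum_delta (R : realType) (T : finType) (c : T) (F : T -> R) :
  \sum_(x : T) (x == c)%:R * F x = F c.
Proof.
rewrite (bigD1 c)//= eqxx mul1r big1 ?addr0// => x /negbTE->.
by rewrite mul0r.
Qed.

(** * Deterministic rules as algorithms: expectations, drift and stopping *)

Section DeterministicPolicy.
Variables (R : realType) (V : finType) (p : R) (act : history V -> V + V).
Variable Rs : responder V.
Hypotheses (p_ge0 : 0 <= p) (p_le1 : p <= 1).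

Definition policy : algorithm R V := fun h => [ffun x => (x == act h)%:R].

Lemma valid_policy : valid_algorithm policy.
Proof.
move=> h; split=> [x|]; first by rewrite ffunE ler0n.
under eq_bigr => x _ do rewrite ffunE -[_%:R]mulr1.
exact: (sum_delta (act h) (fun=> 1)).
Qed.

(** Mass is lost when the rule stops, so this is the expectation of [f] restricted to the event that
    at least [k] queries are made. *)
Definition exp_after k (f : history V -> R) : R :=
  \sum_(h : k.-tuple (V * option V)) reach p policy Rs h * f h.

Definition next (f : history V -> R) (h : history V) (q : V) : R :=
  (1 - p) * f (rcons h (q, (Rs h q).1)) + p * f (rcons h (q, (Rs h q).2)).

Lemma reach_rcons (h : history V) q a :
  reach p policy Rs (rcons h (q, a)) =
  reach p policy Rs h * (policy h (inl q) * ans_prob p Rs h q a).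
Proof.
(* Exposing the empty prefix lets the induction run over an arbitrary past. *)
rewrite /reach -[X in policy X]cat0s -[X in ans_prob _ _ X]cat0s.
elim: h [::] => [|[q' a'] h IH] past; first by rewrite /= cats0 mul1r mulr1.
by rewrite /= IH cat_rcons mulrA.
Qed.

Lemma reach_ge0 (h : history V) : 0 <= reach p policy Rs h.
Proof.
elim/last_ind: h => [|h [q a] IH]; first exact: ler01.
rewrite reach_rcons mulr_ge0// mulr_ge0// ?ffunE ?ler0n//.
by rewrite addr_ge0// mulr_ge0// ?ler0n// subr_ge0.
Qed.

Lemma exp_afterS k f :
  exp_after k.+1 f =
  exp_after k (fun h => if act h is inl q then next f h q else 0).
Proof.
rewrite /exp_after
  (sum_rcons_tuple k (fun h : history V => reach p policy Rs h * f h)).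
apply: eq_bigr => h _.
have -> (F : V * option V -> R) : \sum_x F x = \sum_q \sum_a F (q, a).
  by rewrite pair_bigA; apply: eq_bigr => -[].
have step q : \sum_(a : option V)
    reach p policy Rs (rcons h (q, a)) * f (rcons h (q, a))
  = reach p policy Rs h * (policy h (inl q) * next f h q).
  rewrite /next -!(sum_delta _ (fun a => f (rcons h (q, a)))).
  rewrite !mulr_sumr -big_split /= !mulr_sumr; apply: eq_bigr => a _.
  by rewrite reach_rcons /ans_prob; ring.
under eq_bigr => q _ do rewrite step ffunE.
rewrite -mulr_sumr; congr (_ * _).
case: (act h) => [q|v]; last first.
  by rewrite big1// => q _; rewrite mul0r.
exact: (sum_delta q (next f h)).
Qed.

(** Restricted to reachable histories, because the potential of the search is shown to be
    nonnegative only there. *)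
Lemma exp_after_le k f g :
  (forall h, reach p policy Rs h != 0 -> f h <= g h) ->
  exp_after k f <= exp_after k g.
Proof.
move=> fg; apply: ler_sum => h _.
have [->|/fg] := eqVneq (reach p policy Rs h) 0; first by rewrite !mul0r.
by move=> fg_h; rewrite ler_wpM2l// reach_ge0.
Qed.

Lemma reach_rcons_neq0 (h : history V) q a :
  reach p policy Rs (rcons h (q, a)) != 0 -> act h = inl q.
Proof.
rewrite reach_rcons ffunE; case: (inl q =P act h) => [-> //|_].
by rewrite mul0r mulr0 eqxx.
Qed.

Lemma exp_afterD k f g :
  exp_after k (fun h => f h + g h) = exp_after k f + exp_after k g.
Proof.
by rewrite /exp_after -big_split; apply: eq_bigr => h _; rewrite /= mulrDr.
Qed.

Lemma exp_afterZ k c f : exp_after k (fun h => c * f h) = c * exp_after k f.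
Proof. by rewrite /exp_after mulr_sumr; apply: eq_bigr => h _; ring. Qed.

Lemma exp_afterN k f : exp_after k (fun h => - f h) = - exp_after k f.
Proof. by rewrite /exp_after -sumrN; apply: eq_bigr => h _; rewrite mulrN. Qed.

Lemma exp_after0 f : exp_after 0 f = f [::].
Proof.
rewrite /exp_after (bigD1 [tuple]) //= big1 => [|h]; last by rewrite (tuple0 h).
by rewrite addr0 mul1r.
Qed.

Lemma exp_after_ge0 k f : (forall h, 0 <= f h) -> 0 <= exp_after k f.
Proof. by move=> f0; apply: sumr_ge0 => h _; rewrite mulr_ge0// reach_ge0. Qed.

Definition survival k : R := exp_after k (fun=> 1).

Lemma survival0 : survival 0 = 1.
Proof. exact: exp_after0. Qed.

Lemma survival_ge0 k : 0 <= survival k.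
Proof. exact: exp_after_ge0. Qed.

Lemma survivalS k :
  survival k.+1 = exp_after k (fun h => if act h is inl _ then 1 else 0).
Proof.
rewrite /survival exp_afterS; apply: eq_bigr => h _; congr (_ * _).
by case: (act h) => // q; rewrite /next; ring.
Qed.

Lemma survival_dec k : survival k.+1 <= survival k.
Proof. by rewrite survivalS; apply: exp_after_le => h _; case: (act h). Qed.

Lemma prob_stop_at_survival k :
  prob_stop_at p policy Rs k = survival k - survival k.+1.
Proof.
rewrite survivalS -exp_afterN -exp_afterD; apply: eq_bigr => h _.
congr (_ * _); under eq_bigr => v _ do rewrite ffunE -[_%:R]mulr1.
case: (act h) => [q|v]; last by rewrite (sum_delta v (fun=> 1)); ring.
by rewrite big1 => [|v _]; [ring|rewrite mul0r].
Qed.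

(** Additive drift: each query costs [c] of potential, and telescoping bounds the truncated expected
    number of queries. *)
Lemma survival_potential (Phi : history V -> R) c :
  (forall h, reach p policy Rs h != 0 -> 0 <= Phi h) ->
  (forall h q, act h = inl q -> next Phi h q <= Phi h - c) ->
  forall N, c * \sum_(k < N) survival k.+1 <= Phi [::].
Proof.
move=> Phi0 drift N.
have step k : exp_after k.+1 Phi + c * survival k.+1 <= exp_after k Phi.
  rewrite survivalS -exp_afterZ exp_afterS -exp_afterD.
  apply: exp_after_le => h /Phi0; case E: (act h) => [q|v] Ph.
    by have := drift _ _ E; lra.
  by rewrite mulr0 addr0.
have total : exp_after N Phi + c * \sum_(k < N) survival k.+1 <= Phi [::].
  elim: N => [|N IH]; first by rewrite big_ord0 mulr0 addr0 exp_after0.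
  by rewrite big_ord_recr /=; have := step N; lra.
have : 0 <= exp_after N Phi.
  have -> : 0 = exp_after N (fun=> 0).
    by rewrite /exp_after big1// => h _; rewrite mulr0.
  exact: exp_after_le.
by lra.
Qed.

Definition wrong_at (t : V) k : R :=
  exp_after k (fun h => if act h is inr v then (v != t)%:R else 0).

Lemma prob_return_by_wrong N t :
  prob_return_by p policy Rs N t =
  1 - survival N.+1 - \sum_(k < N.+1) wrong_at t k.
Proof.
rewrite -(sum_survival_diff survival0) -sumrN -big_split; apply: eq_bigr => k _.
rewrite /= survivalS -!exp_afterN -!exp_afterD.
apply: eq_bigr => h _; congr (_ * _); rewrite ffunE.
case: (act h) => [q|v]; first by rewrite /=; ring.
rewrite (inj_eq (@inr_inj _ _)) eq_sym.
by case: eqP => _ /=; ring.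
Qed.

Lemma wrong_potential (G : history V -> R) c Theta t :
  G [::] = 0 -> (forall h, 0 <= G h) ->
  (forall h q, act h = inl q -> next G h q <= G h + c) ->
  (forall h v, act h = inr v -> v != t -> Theta <= G h) ->
  forall N, Theta * \sum_(k < N) wrong_at t k <= c * \sum_(k < N) survival k.+1.
Proof.
move=> G_nil G0 drift stop N.
have step k : exp_after k.+1 G + Theta * wrong_at t k
    <= exp_after k G + c * survival k.+1.
  rewrite survivalS -!exp_afterZ exp_afterS -!exp_afterD.
  apply: exp_after_le => h _; case E: (act h) => [q|v].
    by have := drift _ _ E; lra.
  case: eqP => [|/eqP vt]; first by rewrite mulr0 addr0 mulr0 addr0 G0.
  by have := stop _ _ E vt; rewrite /= mulr1; lra.
have total : exp_after N G + Theta * \sum_(k < N) wrong_at t k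
    <= c * \sum_(k < N) survival k.+1.
  elim: N => [|N IH]; first by rewrite !big_ord0 !mulr0 addr0 exp_after0 G_nil.
  by rewrite !big_ord_recr /=; have := step N; lra.
by have := exp_after_ge0 N G0; lra.
Qed.

Lemma policy_guarantee (Phi G : history V -> R) (c Theta B delta : R) t :
  0 < c -> 0 < Theta -> 0 < delta ->
  Phi [::] <= B -> B <= delta * Theta ->
  (forall h, reach p policy Rs h != 0 -> 0 <= Phi h) ->
  (forall h q, act h = inl q -> next Phi h q <= Phi h - c) ->
  G [::] = 0 -> (forall h, 0 <= G h) ->
  (forall h q, act h = inl q -> next G h q <= G h + c) ->
  (forall h v, act h = inr v -> v != t -> Theta <= G h) ->
  expected_queries_le p policy Rs (B / c) /\
  prob_return_ge p policy Rs t (1 - delta).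
Proof.
move=> c0 Th0 d0 PhiB BT Phi0 Phi_drift G_nil G0 G_drift G_stop.
have time N : c * \sum_(k < N) survival k.+1 <= B.
  exact: le_trans (survival_potential Phi0 Phi_drift N) PhiB.
have wrong N : \sum_(k < N) wrong_at t k <= delta.
  (* [Theta] times the error probability is at most [c] times the expected time, hence at most [B]
     and [delta * Theta]. *)
  rewrite -(ler_pM2l Th0) [leRHS]mulrC; apply: le_trans BT; apply: le_trans (time N).
  exact: (wrong_potential G_nil G0 G_drift G_stop).
have small := survival_small survival_dec c0 time.
split; [split=> [eps /small[N mN]|N]|move=> eps /small[N mN]].
- exists N; under eq_bigr => k _ do rewrite prob_stop_at_survival.
  by rewrite (sum_survival_diff survival0); lra.
- under eq_bigr => k _ do rewrite prob_stop_at_survival.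
  exact: (sum_survival_mean survival_ge0 c0 time).
- exists N; rewrite prob_return_by_wrong.
  by have := wrong N.+1; lra.
Qed.

End DeterministicPolicy.

(** * Weighted medians of a connected graph *)

Section GraphMedian.
Variables (R : realType) (V : finType) (e : rel V).
Hypothesis e_sym : symmetric e.

Lemma exists_dist : (forall x y, connect e x y) ->
  exists d : V -> V -> nat, forall x y,
    (exists s, [/\ path e x s, last x s = y & size s = d x y]) /\
    (forall s, path e x s -> last x s = y -> (d x y <= size s)%N).
Proof.
move=> conn.
have /choice[d dP] : forall xy : V * V, exists n : nat,
    (exists s, [/\ path e xy.1 s, last xy.1 s = xy.2 & size s = n]) /\
    (forall s, path e xy.1 s -> last xy.1 s = xy.2 -> (n <= size s)%N).
  move=> [x y] /=.
  pose P n := `[< exists s, [/\ path e x s, last x s = y & size s = n] >].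
  have exP : exists n, P n.
    by have /connectP[s xs ys] := conn x y; exists (size s); apply/asboolP; exists s.
  case: (ex_minnP exP) => n /asboolP Pn n_min; exists n; split=> // s xs ys.
  by apply: n_min; apply/asboolP; exists s.
by exists (fun x y => d (x, y)) => x y; exact: (dP (x, y)).
Qed.

(** A minimizer of the weighted sum of distances works: moving from [q] to a neighbour [u] shortens
    the distance by 1 to the vertices behind [u] and lengthens the others by at most 1. *)
Lemma exists_median (w : V -> R) :
  (forall x y, connect e x y) -> (forall v, 0 <= w v) -> (0 < #|V|)%N ->
  exists q, forall u,
    \sum_(v | `[< on_shortest_path e q u v >]) w v <= (\sum_v w v) / 2.
Proof.
move=> /exists_dist[d dP] w0 /card_gt0P[v0 _].
pose cost q := \sum_v w v * (d q v)%:R : R.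
case: (@arg_minP _ _ _ v0 predT cost isT) => q _ q_min.
(* If [u] is not a neighbour of [q], the sum is empty. *)
exists q => u; have [qu|nqu] := boolP (e q u); last first.
  rewrite big_pred0 ?divr_ge0 ?sumr_ge0// => v.
  by apply/asboolP => -[s [/= /andP[qu _] _ _]]; rewrite qu in nqu.
set C := (X in X <= _); have /(_ u isT) := q_min.
suff : cost u <= cost q + (\sum_v w v) - 2 * C by lra.
rewrite /cost {}/C [X in 2 * X]big_mkcond mulr_sumr -sumrN -!big_split; apply: ler_sum => v _ /=.
case: asboolP => [[s [qus us short]]|_].
  have [[s' [qs' vs' <-]] _] := dP q v; have [_ dmin] := dP u v.
  have le1 := dmin s (andP qus).2 us; have /= le2 := short _ qs' vs'.
  have -> : w v * (size s')%:R + w v - 2 * w v = w v * ((size s')%:R - 1) by ring.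
  by rewrite ler_wpM2l// lerBrDr natr1 ler_nat (leq_ltn_trans le1).
have [[s [qs vs <-]] _] := dP q v; have [_ dmin] := dP u v.
have /= := dmin (q :: s); rewrite e_sym qu qs => /(_ isT vs) le1.
have -> : w v * (size s)%:R + w v - 2 * 0 = w v * (size s).+1%:R.
  by rewrite -natr1; ring.
by rewrite ler_wpM2l// ler_nat.
Qed.

End GraphMedian.

(** * Weights, wealths and their drift under a valid responder *)

Section BayesianSearch.
Variables (R : realType) (V : finType) (e : rel V) (p : R).
Implicit Types (h : history V) (q u v t : V) (x : V * option V).

Definition compat x v : bool :=
  if x.2 is Some u then `[< on_shortest_path e x.1 u v >] else v == x.1.

(** Scaled by 2, so that an answer compatible with exactly half of the weight preserves the
    total. *)
Definition likelihood x v : R := if compat x v then 2 * (1 - p) else 2 * p.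

Definition weight h v : R := \prod_(x <- h) likelihood x v.

Definition total h : R := \sum_v weight h v.

(** The factors of a stake of the fraction [1 - 2 * p] at even odds; a loss never wipes out the
    wealth. *)
Definition bet (a : option V) : R := if a is None then 2 * (1 - p) else 2 * p.

Definition wealth h v : R :=
  foldl (fun g x => if x.1 == v then (g + Iinfo p) * bet x.2 else g) 0 h.

Lemma weight_rcons h x v : weight (rcons h x) v = weight h v * likelihood x v.
Proof. by rewrite /weight big_rcons /= mulrC. Qed.

Lemma total_rcons h x :
  total (rcons h x) =
  2 * p * total h + 2 * (1 - 2 * p) * \sum_(v | compat x v) weight h v.
Proof.
rewrite /total [X in _ + _ * X]big_mkcond !mulr_sumr -big_split.
apply: eq_bigr => v _; rewrite weight_rcons /likelihood /=.
by case: compat; ring.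
Qed.

Lemma wealth_rcons h q a v :
  wealth (rcons h (q, a)) v =
  if q == v then (wealth h v + Iinfo p) * bet a else wealth h v.
Proof. by rewrite /wealth foldl_rcons. Qed.

(** The empty path already joins [q] to itself. *)
Lemma not_compat_self q u : ~~ compat (q, Some u) q.
Proof. by apply/asboolP => -[s [_ _ /(_ [::] isT erefl)]]. Qed.

Hypotheses (p0 : 0 < p) (p2 : p < 1 / 2).

Lemma likelihood_bounds x v : 2 * p <= likelihood x v <= 2 * (1 - p).
Proof. by move: (p0) (p2) => ? ?; rewrite /likelihood; case: ifP => _; lra. Qed.

Lemma bet_bounds a : 2 * p <= bet a <= 2 * (1 - p).
Proof. by move: (p0) (p2) => ? ?; rewrite /bet; case: a => [_|]; lra. Qed.

Lemma weight_gt0 h v : 0 < weight h v.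
Proof.
move: (p0) => ?; apply: prodr_gt0 => x _.
by have /andP[] := likelihood_bounds x v; lra.
Qed.

Lemma weight_le_total h v : weight h v <= total h.
Proof.
rewrite /total (bigD1 v)//= lerDl sumr_ge0// => u _.
exact/ltW/weight_gt0.
Qed.

Lemma total_gt0 h v : 0 < total h.
Proof. exact: lt_le_trans (weight_gt0 h v) (weight_le_total h v). Qed.

Lemma wealth_ge0 h v : 0 <= wealth h v.
Proof.
have I0 := Iinfo_gt0 p0 p2; elim/last_ind: h => [|h [q a] IH]; first exact: lexx.
rewrite wealth_rcons; case: eqP => // _.
by have /andP[] := bet_bounds a; move: (p0) => ? ? ?; rewrite mulr_ge0; lra.
Qed.

Variables (t : V) (Rs : responder V).
Hypothesis Rs_valid : valid_responder e t Rs.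

Let share h := log2 (total h / weight h t).

Lemma share_ge0 h : 0 <= share h.
Proof.
apply: log2_ge0; rewrite ler_pdivlMr ?weight_gt0// mul1r.
exact: weight_le_total.
Qed.

Lemma next_share_other h q :
  (forall u, \sum_(v | compat (q, Some u) v) weight h v <= total h / 2) ->
  q != t -> next p Rs share h q <= share h - Iinfo p.
Proof.
move=> med qt; have [+ _ _] := Rs_valid h q.
rewrite /correct_answer (negbTE qt) => -[u [c_eq ut]].
rewrite /next /share !total_rcons !weight_rcons c_eq.
have -> : likelihood (q, Some u) t = 2 * (1 - p).
  by rewrite /likelihood /compat /= asboolT.
rewrite [weight h t * _]mulrC.
apply: share_drift_other => //; rewrite ?weight_gt0//.
- exact: (total_gt0 _ t).
- by apply: sumr_ge0 => v _; exact/ltW/weight_gt0.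
- by apply: sumr_ge0 => v _; exact/ltW/weight_gt0.
(* An erroneous direction is covered by the median. An erroneous [None] is compatible with [q]
   alone, which the correct direction excludes, so the two weights add up to at most the total. *)
- case: (Rs h q).2 => [u'|]; first by rewrite med.
  apply/orP; right.
  rewrite [leRHS](bigID (compat (q, Some u))) /= lerD2l /compat /=.
  rewrite big_pred1_eq (bigD1 q) ?(not_compat_self q u)//= lerDl.
  by apply: sumr_ge0 => v _; exact/ltW/weight_gt0.
- rewrite mulrC ler_pM2l ?weight_gt0//.
  by have /andP[] := likelihood_bounds (q, (Rs h q).2) t.
Qed.

(** Here the correct answer is [None] and any error is a direction, which excludes [t]; so the
    weight compatible with the error is at most [W - w]. *)
Lemma next_share_target h : next p Rs share h t <= share h.
Proof.
have [+ err c_neq] := Rs_valid h t; rewrite /correct_answer eqxx => c_eq.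
have {err c_neq} [u e_eq] : exists u, (Rs h t).2 = Some u.
  by case: err => [e0|[u [-> _]]]; [rewrite c_eq e0 in c_neq|exists u].
rewrite /next /share c_eq e_eq !weight_rcons.
have -> : likelihood (t, None) t = 2 * (1 - p) by rewrite /likelihood /compat eqxx.
have -> : likelihood (t, Some u) t = 2 * p.
  by rewrite /likelihood (negbTE (not_compat_self t u)).
set w := weight h t; set W := total h.
have w0 : 0 < w by exact: weight_gt0.
have -> : total (rcons h (t, None)) = 2 * (1 - p) * w + 2 * p * (W - w).
  by rewrite total_rcons /compat /= big_pred1_eq -/w -/W; ring.
rewrite -[in leRHS](subrKC w W) [w * (2 * (1 - p))]mulrC [w * (2 * p)]mulrC.
apply: share_drift_target => //.
- by rewrite subr_ge0 weight_le_total.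
- exact: (total_gt0 _ t).
have E : \sum_(v | compat (t, Some u) v) weight h v <= W - w.
  have -> : W - w = \sum_(v | v != t) weight h v.
    by rewrite /W /total (bigD1 t)//= -/w; ring.
  rewrite big_mkcond [leRHS]big_mkcond; apply: ler_sum => v _.
  have [->|_] := eqVneq v t; first by rewrite (negbTE (not_compat_self t u)).
  by case: ifP => // _; exact/ltW/weight_gt0.
rewrite total_rcons -/W.
have E2 : (1 - 2 * p) * \sum_(v | compat (t, Some u) v) weight h v
    <= (1 - 2 * p) * (W - w).
  by rewrite ler_wpM2l//; move: (p2); lra.
lra.
Qed.

Let surplus h := share h - log2 (1 + wealth h t).

Lemma next_surplus h q :
  (forall u, \sum_(v | compat (q, Some u) v) weight h v <= total h / 2) ->
  next p Rs surplus h q <= surplus h - Iinfo p.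
Proof.
move=> med.
have -> : next p Rs surplus h q =
    next p Rs share h q - next p Rs (fun h => log2 (1 + wealth h t)) h q.
  by rewrite /next /surplus; ring.
have [qt|qt] := eqVneq q t; last first.
  have := next_share_other med qt.
  by rewrite {3}/next !wealth_rcons (negbTE qt) /surplus; lra.
have [+ err c_neq] := Rs_valid h q; rewrite /correct_answer qt eqxx => c_eq.
have {err c_neq} [u e_eq] : exists u, (Rs h t).2 = Some u.
  rewrite qt in err c_neq.
  by case: err => [e0|[u [-> _]]]; [rewrite c_eq e0 in c_neq|exists u].
have := next_share_target h.
have := log_wealth_drift p0 p2 (wealth_ge0 h t).
by rewrite {3}/next !wealth_rcons eqxx c_eq e_eq /bet /surplus; lra.
Qed.

Let wrong_wealth h := \sum_(v | v != t) wealth h v.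

(** At a wrong vertex the correct answer loses the bet, so after the stake is added the mean factor
    is at most [4 p (1 - p)], which is [1 - (1 - 2 p)^2]. *)
Lemma next_wrong_wealth h q : next p Rs wrong_wealth h q <= wrong_wealth h + Iinfo p.
Proof.
have I0 := Iinfo_gt0 p0 p2; rewrite /next /wrong_wealth.
have [->|qt] := eqVneq q t.
  have same a : \sum_(v | v != t) wealth (rcons h (t, a)) v
      = \sum_(v | v != t) wealth h v.
    by apply: eq_bigr => v vt; rewrite wealth_rcons eq_sym (negbTE vt).
  by rewrite !same; lra.
have upd a : \sum_(v | v != t) wealth (rcons h (q, a)) v
    = \sum_(v | v != t) wealth h v
      + ((wealth h q + Iinfo p) * bet a - wealth h q).
  rewrite (bigD1 q)//= [in RHS](bigD1 q)//= wealth_rcons eqxx.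
  rewrite (eq_bigr (wealth h)); first by ring.
  by move=> v /andP[_ vq]; rewrite wealth_rcons eq_sym (negbTE vq).
rewrite !upd; have [+ _ _] := Rs_valid h q.
rewrite /correct_answer (negbTE qt) => -[u [-> _]].
rewrite [bet (Some u)]/bet; set g := wealth h q.
have g0 : 0 <= g by exact: wealth_ge0.
have /andP[_ b1] := bet_bounds (Rs h q).2.
have b2 : (g + Iinfo p) * bet (Rs h q).2 <= (g + Iinfo p) * (2 * (1 - p)).
  by rewrite ler_wpM2l//; lra.
move: (p0) (p2) => p_gt0 p_lt2.
have {}b2 := ler_wpM2l (ltW p_gt0) b2.
have sq : 0 <= (g + Iinfo p) * ((1 - 2 * p) * (1 - 2 * p)).
  by rewrite mulr_ge0 ?mulr_ge0//; lra.
lra.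
Qed.

End BayesianSearch.

(** * Calibration of the stopping threshold *)

Section Threshold.
Variables (R : realType) (l delta : R).

(** Large enough that [delta * threshold] exceeds the time budget; the time bound sees it only
    through its logarithm, so the square of [delta] costs a constant factor. *)
Definition threshold := 16 * (l + 2) / delta ^+ 2.

Lemma threshold_bounds : 0 <= l -> 0 < delta -> delta < 1 / 2 ->
  [/\ 0 < threshold,
      l + log2 (3 + 2 * threshold)
        <= l + 8 * log2 (l + 2) + 8 * log2 (1 / delta)
    & l + 8 * log2 (l + 2) + 8 * log2 (1 / delta) <= delta * threshold].
Proof.
move=> l0 d0 d2; set y := 1 / delta.
have y2 : 2 <= y by rewrite ler_pdivlMr; lra.
have ThE : threshold = 16 * (l + 2) * (y * y).
  by rewrite /threshold /y; field; lra.
have ly : (l + 2) * 2 <= (l + 2) * y by rewrite ler_wpM2l; lra.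
have y4 : 4 <= y * y by have := ler_pM _ _ y2 y2; lra.
have lyy : (l + 2) * 4 <= (l + 2) * (y * y) by rewrite ler_wpM2l; lra.
(* The summand 3 is absorbed because [(l + 2) * (y * y)] is at least 8. *)
have Th4 : 3 + 2 * threshold <= 2 ^+ 6 * (l + 2) * (y * y).
  by rewrite ThE -natrX; lra.
have log64 : log2 (2 ^+ 6 : R) = 6.
  by rewrite /log2 lnXn// mulrnAl divff//; have [? ?] := ln2_bounds R; lra.
have y1 : log2 2 <= log2 y by exact: log2_le.
have l1 : log2 2 <= log2 (l + 2) by apply: log2_le; lra.
rewrite log2_2 in y1 l1.
have y0 : 0 < y by lra.
have key : log2 (2 ^+ 6 * (l + 2) * (y * y)) =
    6 + log2 (l + 2) + (log2 y + log2 y).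
  rewrite (log2M (y := y * y)) ?mulr_gt0 ?invr_gt0 ?exprn_gt0//; try lra.
  rewrite (log2M (x := y))// (log2M (x := 2 ^+ 6)) ?exprn_gt0 ?log64//; lra.
have {}Th4 := log2_le (_ : 0 < 3 + 2 * threshold) Th4.
have {}Th4 := Th4 ltac:(rewrite ThE; lra); rewrite key in Th4.
have ll := @log2_le_id R (l + 2) ltac:(lra).
have lly := @log2_le_id R y ltac:(lra).
split; [by rewrite ThE; lra|by lra|].
have -> : delta * threshold = 16 * ((l + 2) * y).
  by rewrite /threshold /y; field; lra.
have : 0 <= l * y by rewrite mulr_ge0; lra.
lra.
Qed.

End Threshold.

(** * The median search stopped at the wealth threshold *)

Theorem theorem3 (R : realType) :
  exists C : R, 0 < C /\
  forall (V : finType) (e : rel V),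
    symmetric e -> irreflexive e -> (forall x y, connect e x y) ->
    (0 < #|V|)%N ->
    forall p delta : R, 0 < p -> p < 1 / 2 -> 0 < delta -> delta < 1 / 2 ->
    exists A : algorithm R V,
      valid_algorithm A /\
      forall (t : V) (Rs : responder V),
        valid_responder e t Rs ->
        expected_queries_le p A Rs
          ((log2 (#|V|%:R) + C * log2 (log2 (#|V|%:R) + 2)
              + C * log2 (1 / delta)) / Iinfo p) /\
        prob_return_ge p A Rs t (1 - delta).
Proof.
(* The constant 8 is the one in [threshold_bounds]. *)
exists 8; split=> // V e e_sym _ conn V_gt0 p delta p0 p2 d0 d2.
have l0 : 0 <= log2 (#|V|%:R : R) by apply: log2_ge0; rewrite ler1n.
have [Th0 ThB BTh] := threshold_bounds l0 d0 d2.
set l := log2 _ in l0 Th0 ThB BTh *; set Theta := threshold l delta in Th0 ThB BTh.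
have I0 := Iinfo_gt0 p0 p2; have I1 := Iinfo_le1 p0 p2.
have /choice[med medP] : forall h : history V, exists q, forall u,
    \sum_(v | compat e (q, Some u) v) weight e p h v <= total e p h / 2.
  by move=> h; apply: exists_median => // v; apply/ltW/weight_gt0.
pose act h := if [pick v | Theta <= wealth p h v] is Some v then inr v
              else inl (med h).
have act_inl h q : act h = inl q -> q = med h /\ forall v, wealth p h v < Theta.
  rewrite /act; case: pickP => // small [<-]; split=> // v.
  by rewrite ltNge small.
have act_inr h v : act h = inr v -> Theta <= wealth p h v.
  by rewrite /act; case: pickP => // u ? [<-].
exists (policy R act); split; first exact: valid_policy.
move=> t Rs Rs_valid.
(* This shift makes the potential nonnegative on reachable histories. *)
pose lmax := log2 (3 + 2 * Theta).
pose Phi h := log2 (total e p h / weight e p h t) - log2 (1 + wealth p h t) + lmax.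
apply: (policy_guarantee (Phi := Phi)
  (G := fun h => \sum_(v | v != t) wealth p h v) _ _ I0 Th0 d0 _ BTh) => //.
- by lra.
- by lra.
- apply: le_trans ThB; rewrite /Phi /total /weight big_nil.
  under eq_bigr => v _ do rewrite big_nil.
  rewrite sumr_const /= divr1 addr0 -/l.
  by rewrite /log2 ln1 mul0r subr0.
- move=> h reach_h; have w0 := wealth_ge0 p0 p2 h t.
  (* Before the last query the wealth was below [Theta]; one stake of at most 1 and one factor of at
     most 2 follow. *)
  suff : wealth p h t <= 2 * Theta + 2.
    move=> wT; have := share_ge0 e p0 p2 t h.
    have := @log2_le R (1 + wealth p h t) (3 + 2 * Theta) ltac:(lra) ltac:(lra).
    by rewrite /Phi /lmax; lra.
  move: reach_h {w0}; case/lastP: h => [_|h [q a]]; first by rewrite /wealth /=; lra.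
  move=> /reach_rcons_neq0/act_inl[_ /(_ t) wT]; have w0 := wealth_ge0 p0 p2 h t.
  rewrite wealth_rcons; case: ifP => _; last by lra.
  have /andP[b1 b2] := bet_bounds p0 p2 a.
  have : (wealth p h t + Iinfo p) * bet p a <= (wealth p h t + Iinfo p) * 2.
    by rewrite ler_wpM2l; lra.
  by lra.
- move=> h q /act_inl[-> _].
  have := next_surplus p0 p2 Rs_valid (medP h).
  by rewrite /next /Phi; lra.
- by rewrite big1.
- by move=> h; apply: sumr_ge0 => v _; apply: wealth_ge0.
- by move=> h q _; exact: (next_wrong_wealth p0 p2 Rs_valid).
- move=> h v /act_inr wT vt; rewrite (bigD1 v)//=.
  by apply: ler_wpDr => //; apply: sumr_ge0 => u _; apply: wealth_ge0.
Qed.
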